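(* Let $A\in\mathbb{R}_{\geq 0}^{m\times n}$ and $b\in\mathbb{R}_{\geq 0}^{m}$, and consider the LP $\min\{\|x\|_1\mid Ax\geq b,\ x\geq 0\}$ with optimal value $\mathit{LIN}>0$. Let $\delta>0$, $\alpha>0$, and let $x'$ be a feasible solution with $\|x'\|_1\leq(1+\delta)\mathit{LIN}$ and $\|x'\|_1\geq\alpha(1/\delta+1)$. Define $x^{var}=\frac{\alpha(1/\delta+1)}{\|x'\|_1}x'$, $x^{fix}=x'-x^{var}$, $b^{var}=b-Ax^{fix}$, let $\hat{x}$ be any optimal solution of the LP $\min\{\|x\|_1\mid Ax\geq b^{var},\ x\geq 0\}$, and set $x''=x^{fix}+\hat{x}$. Then $x''$ is a feasible solution of the original LP (i.e. $Ax''\geq b$, $x''\geq 0$), $\|x''\|_1\leq(1+\delta)\mathit{LIN}-\alpha$, and $\|x''-x'\|_1\leq 2\alpha(1/\delta+1)$.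
   Context: $\|\cdot\|_1$ is the $\ell_1$-norm. The construction of $x''$ described in the claim is the paper's ''Algorithm 1''. *)

(* Defs.v *)
From mathcomp Require Import all_boot all_order all_algebra.
From mathcomp Require Import reals.
Set Implicit Arguments.
Unset Strict Implicit.
Unset Printing Implicit Defensive.
Import Order.TTheory GRing.Theory Num.Theory.
Local Open Scope ring_scope.

Definition mxle (R : realType) (m n : nat) (A B : 'M[R]_(m, n)) : Prop :=
  forall i j, A i j <= B i j.

Definition l1norm (R : realType) (n : nat) (x : 'cV[R]_n) : R :=
  \sum_(i < n) `|x i 0|.

(* The linear program min {||x||_1 | A x >= b, x >= 0}; the right-hand side b
   is allowed to have negative entries. *)
Definition lp_feasible (R : realType) (m n : nat) (A : 'M[R]_(m, n))
    (b : 'cV[R]_m) (x : 'cV[R]_n) : Prop :=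
  mxle b (A *m x) /\ mxle 0 x.

Definition lp_optimal (R : realType) (m n : nat) (A : 'M[R]_(m, n))
    (b : 'cV[R]_m) (x : 'cV[R]_n) : Prop :=
  lp_feasible A b x /\
  forall y : 'cV[R]_n, lp_feasible A b y -> l1norm x <= l1norm y.

Definition lp_optval (R : realType) (m n : nat) (A : 'M[R]_(m, n))
    (b : 'cV[R]_m) (v : R) : Prop :=
  exists2 x : 'cV[R]_n, lp_optimal A b x & l1norm x = v.

(* Main.v *)
(* Write N = ||x'||_1, K = alpha (1/delta + 1) and t = K / N <= 1, so that
   x^var = t x' and x^fix = (1 - t) x'.  Both x^var and t x*, for x* optimal in
   the original LP, are feasible for the right-hand side b^var, hence
   ||xhat||_1 <= K and ||xhat||_1 <= t LIN.  The first bound gives the distance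
   estimate; the second gives ||x''||_1 <= N - K + K LIN / N, which is at most
   (1 + delta) LIN - alpha because K <= N <= (1 + delta) LIN. *)

Require Import Defs.
From mathcomp Require Import all_boot all_order all_algebra.
From mathcomp Require Import reals ring lra.
Import Order.TTheory GRing.Theory Num.Theory.
Local Open Scope ring_scope.

Lemma l1norm_triangle (R : realType) (n : nat) (x y : 'cV[R]_n) :
  l1norm (x + y) <= l1norm x + l1norm y.
Proof.
by rewrite -big_split; apply: ler_sum => i _; rewrite mxE ler_normD.
Qed.

Lemma l1normN (R : realType) (n : nat) (x : 'cV[R]_n) :
  l1norm (- x) = l1norm x.
Proof. by apply: eq_bigr => i _; rewrite mxE normrN. Qed.

Lemma l1normZ (R : realType) (n : nat) (t : R) (x : 'cV[R]_n) :
  l1norm (t *: x) = `|t| * l1norm x.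
Proof. by rewrite mulr_sumr; apply: eq_bigr => i _; rewrite mxE normrM. Qed.

Lemma mxle0Z (R : realType) (m n : nat) (t : R) (A : 'M[R]_(m, n)) :
  0 <= t -> mxle 0 A -> mxle 0 (t *: A).
Proof.
by move=> t0 A0 i j; have := A0 i j; rewrite !mxE; apply: mulr_ge0.
Qed.

Lemma lp_feasible_add (R : realType) (m n : nat) (A : 'M[R]_(m, n))
    (b : 'cV[R]_m) (x y : 'cV[R]_n) :
  mxle 0 x -> lp_feasible A (b - A *m x) y -> lp_feasible A b (x + y).
Proof.
move=> x0 [Ay y0]; split=> i j.
  by have := Ay i j; rewrite mulmxDr !mxE lerBlDl.
by have := x0 i j; have := y0 i j; rewrite !mxE => *; rewrite addr_ge0.
Qed.

(** After moving [A *m (x - t *: x)] across, the constraint is the convex combination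
    [(1 - t) A x + t A y >= b] of the two given ones. *)
Lemma lp_feasible_residual (R : realType) (m n : nat) (A : 'M[R]_(m, n))
    (b : 'cV[R]_m) (t : R) (x y : 'cV[R]_n) :
  0 <= t <= 1 -> lp_feasible A b x -> lp_feasible A b y ->
  lp_feasible A (b - A *m (x - t *: x)) (t *: y).
Proof.
move=> /andP[t0 t1] [Ax _] [Ay y0]; split; last exact: mxle0Z.
move=> i j; have := Ax i j; have := Ay i j.
rewrite mulmxBr -!scalemxAr !mxE; set u := \sum_k _; set v := \sum_k _.
nra.
Qed.

Theorem theorem3 (R : realType) (m n : nat) (A : 'M[R]_(m, n)) (b : 'cV[R]_m)
    (LIN delta alpha : R) (x' xhat : 'cV[R]_n)
    (hA : mxle 0 A) (hb : mxle 0 b)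
    (hLIN : lp_optval A b LIN) (hLIN_gt0 : 0 < LIN)
    (hdelta : 0 < delta) (halpha : 0 < alpha)
    (hx' : lp_feasible A b x')
    (hx'_le : l1norm x' <= (1 + delta) * LIN)
    (hx'_ge : alpha * (1 / delta + 1) <= l1norm x') :
  let xvar := (alpha * (1 / delta + 1) / l1norm x') *: x' in
  let xfix := x' - xvar in
  let bvar := b - A *m xfix in
  let x'' := xfix + xhat in
  lp_optimal A bvar xhat ->
  [/\ lp_feasible A b x'',
      l1norm x'' <= (1 + delta) * LIN - alpha
    & l1norm (x'' - x') <= 2 * alpha * (1 / delta + 1)].
Proof.
move=> xvar xfix bvar x'' [xhatF xhatO].
case: hLIN => xs [xsF _] xsE.
(* The local definitions go back into the goal so that [set] folds [N], [K] and [t] inside their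
   bodies too. *)
move: (hx'_le) (hx'_ge) @xvar @xfix @bvar @x'' xhatF xhatO.
set N := l1norm x'; set K := alpha * _; set t := K / N => N_le K_le.
move=> xvar xfix bvar x'' xhatF xhatO.
have K0 : 0 < K by rewrite mulr_gt0 // addr_gt0 // divr_gt0.
have N0 : 0 < N by exact: lt_le_trans K_le.
have t01 : 0 <= t <= 1.
  by rewrite /t (divr_ge0 (ltW K0) (ltW N0)) ler_pdivrMr // mul1r.
have [t0 t1] := andP t01.
have tN : t * N = K by rewrite /t divfK // gt_eqF.
(* Clearing [1 / delta] in [K]; this later expresses [alpha] through [t], [N] and [delta]. *)
have KE : K * delta = alpha * (1 + delta).
  by rewrite /K; field; rewrite gt_eqF.
have xfixE : xfix = (1 - t) *: x' by rewrite scalerBl scale1r.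
have t1' : 0 <= 1 - t by rewrite subr_ge0.
have xfix_ge0 : mxle 0 xfix by rewrite xfixE; apply: mxle0Z => //; case: hx'.
have xvar_norm : l1norm xvar = K by rewrite l1normZ ger0_norm.
have xhat_le_K : l1norm xhat <= K.
  by rewrite -xvar_norm; apply/xhatO/lp_feasible_residual.
have xhat_le_LIN : l1norm xhat <= t * LIN.
  rewrite -xsE -[t in t * _]ger0_norm // -l1normZ.
  exact/xhatO/lp_feasible_residual.
split; first exact: lp_feasible_add.
- have /le_trans -> // : l1norm x'' <= (1 - t) * N + t * LIN.
    rewrite (le_trans (l1norm_triangle _ _ _ _)) // lerD //.
    by rewrite xfixE l1normZ ger0_norm.
  have alphaE : alpha = t * N * delta / (1 + delta).
    by rewrite tN KE mulfK // gt_eqF // addr_gt0.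
  have d1 : 1 + delta != 0 by rewrite gt_eqF // addr_gt0.
  (* The slack factors: the first factor is nonnegative by the approximation guarantee on [x'], the
     second because [t <= 1 <= 1 + delta]. *)
  rewrite -subr_ge0.
  have -> : (1 + delta) * LIN - alpha - ((1 - t) * N + t * LIN) =
            ((1 + delta) * LIN - N) * (1 - t / (1 + delta)).
    by rewrite alphaE; field.
  rewrite mulr_ge0 ?subr_ge0 // ler_pdivrMr ?addr_gt0 // mul1r.
  by rewrite (le_trans t1) // lerDl ltW.
(* The fixed part cancels, leaving two vectors of norm at most [K] each. *)
- have -> : x'' - x' = xhat - xvar.
    by rewrite /x'' /xfix addrAC addrC addrAC subrr add0r.
  rewrite (le_trans (l1norm_triangle _ _ _ _)) // l1normN xvar_norm.
  by rewrite -mulrA -/K mulr_natl mulr2n lerD2r.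
Qed.
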